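(* Let $0\le\delta<1$, $\alpha_1\ge 1$, $0<\alpha_2\le 1$, and let $\pi_1,\pi_2>0$ with $\pi_1+\pi_2<1$. Define, for $x\in[0,1]$, $L_i(x)=0$ for $0\le x\le\delta$ ($i=1,2,3$) and, for $\delta\le x\le 1$, $$L_1(x)=\frac{x-\delta}{1-\delta},\qquad L_2(x)=\left(\frac{x-\delta}{1-\delta}\right)^{\alpha_1},\qquad L_3(x)=1-\left(1-\frac{x-\delta}{1-\delta}\right)^{\alpha_2},$$ and $L_4(x)=\pi_1L_1(x)+\pi_2L_2(x)+(1-\pi_1-\pi_2)L_3(x)$. Let $G_i$ denote the Gini index of $L_i$ and $G_i(\nu)$ its generalized Gini index with parameter $\nu>1$. Then $$G_1=\delta,\qquad G_2=\frac{\alpha_1+2\delta-1}{1+\alpha_1},\qquad G_3=\frac{1-\alpha_2+2\alpha_2\delta}{1+\alpha_2},$$ $$G_4=\pi_1\delta+\pi_2\frac{\alpha_1-1+2\delta}{1+\alpha_1}+(1-\pi_1-\pi_2)\frac{1-\alpha_2+2\alpha_2\delta}{1+\alpha_2},$$ and, for every real $\nu>1$, $$G_1(\nu)=1-(1-\delta)^\nu,\qquad G_2(\nu)=1-\frac{\nu(\nu+1)(1-\delta)^\nu\,\Gamma(\nu)\,\Gamma(\alpha_1+1)}{\Gamma(1+\alpha_1+\nu)},\qquad G_3(\nu)=1-\frac{(1+\nu)\,\alpha_2\,(1-\delta)^\nu}{\alpha_2+\nu}.$$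
   Context: For a Lorenz curve $L:[0,1]\to[0,1]$, the Gini index is $G=2\int_0^1[x-L(x)]\,dx=1-2\int_0^1L(x)\,dx$, and the generalized Gini index (Donaldson–Weymark–Kakwani–Yitzhaki) with parameter $\nu>1$ is $$G(\nu)=1-\nu(\nu+1)\int_0^1(1-p)^{\nu-1}L(p)\,dp.$$ $\Gamma$ denotes the Euler gamma function. *)

(* Defs.v *)
From mathcomp Require Import all_boot all_order all_algebra.
From mathcomp Require Import all_classical all_reals all_analysis.

Set Implicit Arguments.
Unset Strict Implicit.
Unset Printing Implicit Defensive.

Import Order.TTheory GRing.Theory Num.Theory.
Import numFieldNormedType.Exports.

Local Open Scope classical_set_scope.
Local Open Scope ring_scope.

(* Lorenz curves are functions on [0, 1]; they are encoded as total functions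
   R -> R, and every index below only reads their values on [0, 1]. *)

Definition gini (R : realType) (L : R -> R) : R :=
  2 * \int[lebesgue_measure]_(x in `[0, 1]) (x - L x).

Definition generalized_gini (R : realType) (nu : R) (L : R -> R) : R :=
  1 - nu * (nu + 1) *
      \int[lebesgue_measure]_(p in `[0, 1]) ((1 - p) `^ (nu - 1) * L p).

(* Euler's integral; the integrand is integrable exactly when 0 < z. *)
Definition Gamma (R : realType) (z : R) : R :=
  \int[lebesgue_measure]_(t in `]0, +oo[) (t `^ (z - 1) * expR (- t)).

Definition lorenz1 (R : realType) (delta : R) (x : R) : R :=
  if x <= delta then 0 else (x - delta) / (1 - delta).

Definition lorenz2 (R : realType) (delta alpha1 : R) (x : R) : R :=
  if x <= delta then 0 else ((x - delta) / (1 - delta)) `^ alpha1.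

Definition lorenz3 (R : realType) (delta alpha2 : R) (x : R) : R :=
  if x <= delta then 0
  else 1 - (1 - (x - delta) / (1 - delta)) `^ alpha2.

Definition lorenz4 (R : realType) (delta alpha1 alpha2 pi1 pi2 : R)
    (x : R) : R :=
  pi1 * lorenz1 delta x + pi2 * lorenz2 delta alpha1 x
    + (1 - pi1 - pi2) * lorenz3 delta alpha2 x.

(* Main.v *)
Require Import Defs.
From mathcomp Require Import all_boot all_order all_algebra.
From mathcomp Require Import all_classical all_reals all_analysis.
From mathcomp Require Import measurable_realfun ring lra.

Import Order.TTheory GRing.Theory Num.Theory.
Import numFieldNormedType.Exports.

Local Open Scope ring_scope.

(** Every curve here is a fixed profile [f] on [[0, 1]], with [f 0 = 0],
    rescaled to [[delta, 1]] and extended by zero.  The substitution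
    [x = delta + (1 - delta) * u] turns the weight [(1 - x) `^ (nu - 1)] into
    [(1 - delta) `^ (nu - 1) * (1 - u) `^ (nu - 1)], so the generalized index
    only depends on [delta] through the factor [(1 - delta) `^ nu]
    ([generalized_gini_profiled]), and what remains is the moment of [f]
    against [(1 - u) `^ (nu - 1)].  The ordinary Gini index is the case
    [nu = 1] ([gini_generalized]) and is affine in the curve
    ([gini_mixture]).

    Two families of moments suffice.  For [f u = 1 - (1 - u) `^ alpha] the
    moment is elementary ([moment_onem_pospow]); the first curve is the
    member [alpha = 1] of this family.  For [f u = u `^ alpha] it is Euler's
    beta integral ([moment_pospow]), which [beta_Gamma] expresses through
    [Gamma].  That identity is the convolution formula for gamma densities:
    with [k_p t = t `^ p * expR (- t)] on the half-line, scaling [[0, u]] to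
    [[0, 1]] gives [k_p * k_q = B * k_(p + q + 1)] for a constant [B] equal to
    the beta integral ([gamma_kernel_convolution]), while Tonelli's theorem
    and translation invariance say that the total mass of a convolution is the
    product of the masses ([gamma_mass_mul]).  Comparing the two masses gives
    the identity, once the masses are known to be finite and positive. *)

(** * Powers and integrals over the unit interval *)

Section continuous_integrands.
Local Set Implicit Arguments.
Local Unset Strict Implicit.
Local Open Scope classical_set_scope.
Context {R : realType}.
Implicit Types (f G : R -> R) (a b c d p x : R).
Let mu := @lebesgue_measure R.

(** A power function truncated at the origin: [x `^ p] is 1 at negative [x],
    hence discontinuous at 0 when [p > 0], whereas this variant is continuous
    on the whole line and agrees with it where the integrals live. *)
Definition pospow p x : R := Num.max x 0 `^ p.

Lemma pospowE p x : 0 <= x -> pospow p x = x `^ p.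
Proof. by move=> x0; rewrite /pospow max_l. Qed.

Lemma pospow_ge0 p x : 0 <= pospow p x.
Proof. exact: powR_ge0. Qed.

Lemma continuous_pospow p : 0 <= p -> continuous (pospow p).
Proof.
rewrite le_eqVlt => /predU1P[<- x|p0 x].
  rewrite (_ : pospow 0 = cst 1); first exact: cst_continuous.
  by apply/funext => y; rewrite /pospow powRr0.
case: (ltgtP x 0) => [x0|x0|->].
- apply: cvg_near_cst; near=> z.
  rewrite /pospow !max_r//; first exact: ltW.
  by apply: ltW; near: z; exact: lt_nbhsl.
- rewrite /continuous_at pospowE ?ltW//.
  suff : z `^ p @[z --> x] --> x `^ p.
    apply: cvg_trans; apply: near_eq_cvg; near=> z.
    by rewrite pospowE//; apply: ltW; near: z; exact: lt_nbhsr.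
  suff : {for x, continuous (@powR R ^~ p)} by [].
  apply/differentiable_continuous/derivable1_diffP.
  by apply: derivable_powR; rewrite in_itv/= x0.
- apply/left_right_continuousP; split; rewrite pospowE// powR0 ?gt_eqF//.
    apply: cvg_near_cst; near=> z.
    by rewrite /pospow max_r// powR0// gt_eqF.
  have := powR_cvg0 p0; apply: cvg_trans; apply: near_eq_cvg; near=> z.
  by rewrite pospowE.
Unshelve. all: end_near. Qed.

Lemma continuous_integrable_itv f a b :
  continuous f -> mu.-integrable `[a, b] (EFin \o f).
Proof.
move=> cf; apply: continuous_compact_integrable; first exact: segment_compact.
exact: continuous_subspaceT.
Qed.

Lemma Rintegral_affine G c d : 0 < c -> continuous G ->
  \int[mu]_(x in `[d, d + c]) G x = c * \int[mu]_(x in `[0, 1]) G (d + c * x).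
Proof.
move=> c0 cG.
pose F := fun x : R => d + c * x.
have cF : continuous F.
  by move=> x; apply: cvgD; [exact: cvg_cst|apply: cvgM => //; exact: cvg_cst].
have dF x : is_derive x 1 F c.
  have := is_deriveD (is_derive_cst d x 1) (is_deriveZ c (is_derive_id x 1)).
  by rewrite add0r /GRing.scale/= mulr1.
have F'E : F^`() = cst c.
  by apply/funext => x; rewrite derive1E derive_val.
have := @integration_by_substitution_increasing R F G 0 1 ler01.
rewrite /F mulr0 addr0 mulr1 -/F => H.
rewrite {1}/Rintegral H//.
- rewrite -/(Rintegral mu `[0, 1] ((G \o F) * F^`()%classic)).
  rewrite -RintegralZl//.
    by apply: eq_Rintegral => x _; rewrite F'E mulrC.
  apply: continuous_integrable_itv => x.
  by apply: continuous_comp; [exact: cF|exact: cG].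
- by move=> x y _ _ xy; rewrite /F ltrD2l ltr_pM2l.
- by rewrite F'E => x _; exact: cvg_cst.
- by rewrite F'E; exact: is_cvg_cst.
- by rewrite F'E; exact: is_cvg_cst.
- split => [x _||]; first by have [] := dF x.
    by apply: cvg_at_right_filter; exact: cF.
  by apply: cvg_at_left_filter; exact: cF.
- exact: continuous_subspaceT.
Qed.

Lemma Rintegral_powR01 p : 0 <= p ->
  \int[mu]_(x in `[0, 1]) (x `^ p) = (p + 1)^-1.
Proof.
move=> p0.
have p1 : p + 1 != 0 by rewrite gt_eqF// ltr_wpDl.
pose F x := pospow (p + 1) x * (p + 1)^-1.
have cF : continuous F.
  move=> x; apply: cvgM; last exact: cvg_cst.
  by apply: continuous_pospow; rewrite addr_ge0.
have dF x : 0 < x -> is_derive x 1 F (pospow p x).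
  move=> x0.
  have := is_deriveZ (p + 1)^-1 (is_derive1_powR (p + 1) x0).
  rewrite /GRing.scale/= addrK mulrA mulVf// mul1r -pospowE ?ltW//.
  apply: near_eq_is_derive; near=> z.
  by rewrite /= /F pospowE 1?mulrC//; apply: ltW; near: z; exact: lt_nbhsr.
transitivity (\int[mu]_(x in `[0, 1]) pospow p x).
  apply: eq_Rintegral => x; rewrite inE/= in_itv/= => /andP[x0 _].
  by rewrite pospowE.
rewrite /Rintegral (@continuous_FTC2 _ (pospow p) F)//.
- rewrite /= /F !pospowE// powR0// mul0r subr0 powR1 mul1r//.
- exact/continuous_subspaceT/continuous_pospow.
- split => [x||].
  + by rewrite in_itv/= => /andP[x0 _]; have [] := dF _ x0.
  + by apply: cvg_at_right_filter; exact: cF.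
  + by apply: cvg_at_left_filter; exact: cF.
- move=> x; rewrite in_itv/= => /andP[x0 _].
  by rewrite derive1E; have [_ ->] := dF _ x0.
Unshelve. all: end_near. Qed.

Lemma Rintegral_onem G : continuous G ->
  \int[mu]_(x in `[0, 1]) G (1 - x) = \int[mu]_(x in `[0, 1]) G x.
Proof.
move=> cG; rewrite [RHS]Rintegration_by_substitution_onem ?lexx ?ler01//.
  by rewrite /unstable.onem subrr.
exact: continuous_subspaceT.
Qed.

Lemma continuous_onem_comp G : continuous G -> continuous (fun x => G (1 - x)).
Proof.
move=> cG x; apply: continuous_comp; last exact: cG.
by apply: cvgB => //; exact: cvg_cst.
Qed.

Lemma Rintegral_onem_powR01 p : 0 <= p ->
  \int[mu]_(x in `[0, 1]) ((1 - x) `^ p) = (p + 1)^-1.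
Proof.
move=> p0; rewrite -Rintegral_powR01//.
transitivity (\int[mu]_(x in `[0, 1]) pospow p x); last first.
  apply: eq_Rintegral => x /[!inE]/= /[!in_itv]/= /andP[? _].
  by rewrite pospowE.
rewrite -(Rintegral_onem (continuous_pospow p0)).
apply: eq_Rintegral => x /[!inE]/= /[!in_itv]/= /andP[? ?].
by rewrite pospowE// subr_ge0.
Qed.

End continuous_integrands.

(** * Gini indices *)

Section gini_index.
Local Set Implicit Arguments.
Local Unset Strict Implicit.
Local Open Scope classical_set_scope.
Context {R : realType}.
Implicit Types L : R -> R.
Let mu := @lebesgue_measure R.

Lemma gini_integral L : mu.-integrable `[0, 1] (EFin \o L) ->
  gini L = 1 - 2 * \int[mu]_(x in `[0, 1]) L x.
Proof.
move=> iL; rewrite /gini RintegralB//; last first.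
  by apply: (@continuous_integrable_itv R id) => x; exact: cvg_id.
have -> : \int[mu]_(x in `[0, 1]) x = 2^-1.
  have -> : 2^-1 = (1 + 1)^-1 :> R by [].
  rewrite -Rintegral_powR01//.
  by apply: eq_Rintegral => x /[!inE]/= /[!in_itv]/= /andP[? _]; rewrite powRr1.
by field.
Qed.

Lemma gini_generalized L : mu.-integrable `[0, 1] (EFin \o L) ->
  gini L = generalized_gini 1 L.
Proof.
move=> iL; rewrite gini_integral// /generalized_gini mul1r; congr (_ - _ * _).
by apply: eq_Rintegral => x _; rewrite subrr powRr0 mul1r.
Qed.

Lemma gini_mixture L1 L2 L3 (a b : R) :
    mu.-integrable `[0, 1] (EFin \o L1) ->
    mu.-integrable `[0, 1] (EFin \o L2) ->
    mu.-integrable `[0, 1] (EFin \o L3) ->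
  gini (fun x => a * L1 x + b * L2 x + (1 - a - b) * L3 x) =
  a * gini L1 + b * gini L2 + (1 - a - b) * gini L3.
Proof.
have iZ k L : mu.-integrable `[0, 1] (EFin \o L) ->
    mu.-integrable `[0, 1] (EFin \o (fun x => k * L x)).
  by move=> iL; apply: eq_integrable (integrableZl _ k iL).
have iD L L' : mu.-integrable `[0, 1] (EFin \o L) ->
    mu.-integrable `[0, 1] (EFin \o L') ->
    mu.-integrable `[0, 1] (EFin \o (fun x => L x + L' x)).
  by move=> iL iL'; apply: eq_integrable (integrableD _ iL iL').
move=> i1 i2 i3; rewrite !gini_integral//; last first.
  by apply: (iD); [apply: iD|]; exact: iZ.
rewrite RintegralD//; [|by apply: iD; exact: iZ|exact: iZ].
rewrite RintegralD//; [|exact: iZ..].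
by rewrite !RintegralZl//; ring.
Qed.

End gini_index.

(** * Curves supported on the upper part of the unit interval *)

Section lorenz_curves.
Local Set Implicit Arguments.
Local Unset Strict Implicit.
Local Open Scope classical_set_scope.
Context {R : realType}.
Implicit Types (f L : R -> R) (x : R).
Let mu := @lebesgue_measure R.
Variable delta : R.
Hypotheses (delta_ge0 : 0 <= delta) (delta_lt1 : delta < 1).

(** Clamping the rescaled variable at 0 encodes the vanishing of [L] on
    [[0, delta]] when [f 0 = 0], and makes the right-hand side continuous as
    soon as [f] is. *)
Definition profiled_by f L :=
  forall x, 0 <= x <= 1 -> L x = f (Num.max ((x - delta) / (1 - delta)) 0).

Let d1_gt0 : 0 < 1 - delta. Proof. by rewrite subr_gt0. Qed.

Lemma lorenz2_profile alpha : 0 < alpha ->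
  profiled_by (pospow alpha) (lorenz2 delta alpha).
Proof.
move=> a0 x _; rewrite /lorenz2; case: (leP x delta) => xd.
  rewrite max_r ?pospowE// ?powR0 ?gt_eqF//.
  by rewrite pmulr_lle0 ?invr_gt0// subr_le0.
have x0 : 0 <= (x - delta) / (1 - delta) by rewrite divr_ge0// ltW// subr_gt0.
by rewrite max_l// pospowE.
Qed.

Lemma lorenz3_profile alpha :
  profiled_by (fun u => 1 - pospow alpha (1 - u)) (lorenz3 delta alpha).
Proof.
move=> x /andP[_ x1]; rewrite /lorenz3; case: (leP x delta) => xd.
  rewrite max_r ?subr0 ?pospowE// ?powR1 ?subrr//.
  by rewrite pmulr_lle0 ?invr_gt0// subr_le0.
rewrite max_l ?pospowE//; last by rewrite divr_ge0// ltW// subr_gt0.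
by rewrite subr_ge0 ler_pdivrMr// mul1r lerD2r.
Qed.

(** The linear curve is the case [alpha = 1] of the third family; this form
    gives its moments without computing a beta value. *)
Lemma lorenz1_profile :
  profiled_by (fun u => 1 - pospow 1 (1 - u)) (lorenz1 delta).
Proof.
move=> x x01; rewrite -lorenz3_profile// /lorenz1 /lorenz3.
case: ifPn => //; rewrite -ltNge => xd; rewrite powRr1; first by ring.
by rewrite subr_ge0 ler_pdivrMr// mul1r lerD2r; case/andP: x01.
Qed.

Lemma continuous_profile f : continuous f ->
  continuous (fun x => f (Num.max ((x - delta) / (1 - delta)) 0)).
Proof.
move=> cf x.
suff cm : {for x, continuous (fun x => Num.max ((x - delta) / (1 - delta)) 0)}.
  by apply: continuous_comp; [exact: cm|exact: cf].
apply: (@continuous_max R R (fun x => (x - delta) / (1 - delta)) (cst 0)).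
  by apply: cvgM; [apply: cvgB; [exact: cvg_id|exact: cvg_cst]|exact: cvg_cst].
exact: cvg_cst.
Qed.

Lemma profiled_integrable f L : continuous f -> profiled_by f L ->
  mu.-integrable `[0, 1] (EFin \o L).
Proof.
move=> /continuous_profile /continuous_integrable_itv + fL.
move=> /(_ 0 1); apply: eq_integrable => // x.
by rewrite inE/= in_itv/= => x01; rewrite fL.
Qed.

(** The interval [[0, delta]] contributes nothing, and on [[delta, 1]] the
    substitution [x = delta + (1 - delta) * u] gives
    [1 - x = (1 - delta) * (1 - u)]: one factor [1 - delta] comes from the
    measure and the other [nu - 1] from the weight. *)
Lemma Rintegral_onem_powR_profiled nu f L : 1 <= nu ->
    continuous f -> f 0 = 0 -> profiled_by f L ->
  \int[mu]_(x in `[0, 1]) ((1 - x) `^ (nu - 1) * L x) =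
  (1 - delta) `^ nu * \int[mu]_(u in `[0, 1]) ((1 - u) `^ (nu - 1) * f u).
Proof.
move=> nu1 cf f0 fL.
pose H x := pospow (nu - 1) (1 - x) * f (Num.max ((x - delta) / (1 - delta)) 0).
have nu0 : 0 <= nu - 1 by rewrite subr_ge0.
have cw : continuous (fun x : R => pospow (nu - 1) (1 - x)).
  by apply: continuous_onem_comp; exact: continuous_pospow.
have cH : continuous H.
  by move=> x; apply: cvgM; [exact: cw|exact: continuous_profile].
transitivity (\int[mu]_(x in `[0, 1]) H x).
  apply: eq_Rintegral => x /[!inE]/= /[!in_itv]/= x01.
  by rewrite /H fL// pospowE// subr_ge0; case/andP: x01.
transitivity (\int[mu]_(x in `[delta, 1]) H x).
  have := @Rintegral_itvB R H (BLeft 0) (BRight 1) delta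
    (continuous_integrable_itv 0 1 cH).
  rewrite !bnd_simp delta_ge0 (ltW delta_lt1) => /(_ erefl erefl).
  rewrite [X in _ - X](_ : _ = 0) ?subr0 => [->|].
    rewrite Rintegral_itv_obnd_cbnd//.
    apply: integrableS (continuous_integrable_itv delta 1 cH) => //.
    exact: subset_itv_oc_cc.
  transitivity (\int[mu]_(x in `[0%R, delta]) (cst 0 x : R)).
    apply: eq_Rintegral => x /[!inE]/= /[!in_itv]/= /andP[_ xd].
    rewrite /H max_r ?f0 ?mulr0//.
    by rewrite pmulr_lle0 ?invr_gt0// subr_le0.
  by rewrite Rintegral_cst// mul0r.
have := Rintegral_affine delta d1_gt0 cH; rewrite subrKC => ->.
have -> : (1 - delta) `^ nu = (1 - delta) * (1 - delta) `^ (nu - 1).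
  by rewrite mulr_powRB1// ?ltW//; apply: lt_le_trans nu1.
rewrite -mulrA; congr (_ * _).
rewrite -RintegralZl//.
  apply: eq_Rintegral => u /[!inE]/= /[!in_itv]/= /andP[u0 u1].
  rewrite /H [delta + _ - delta]addrC addKr.
  rewrite [(1 - delta) * u]mulrC mulfK ?gt_eqF//.
  rewrite max_l// (_ : 1 - (delta + _) = (1 - delta) * (1 - u)); last by ring.
  by rewrite pospowE ?powRM -?mulrA ?mulr_ge0// ?subr_ge0// ltW.
apply: (@eq_integrable _ _ _ mu _ _
  (EFin \o (fun u => pospow (nu - 1) (1 - u) * f u))) => //.
  move=> u /[!inE]/= /[!in_itv]/= /andP[u0 u1].
  by rewrite pospowE// subr_ge0.
apply: continuous_integrable_itv => x; apply: cvgM; [exact: cw|exact: cf].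
Qed.

Lemma generalized_gini_profiled nu f L : 1 <= nu ->
    continuous f -> f 0 = 0 -> profiled_by f L ->
  generalized_gini nu L = 1 - nu * (nu + 1) * (1 - delta) `^ nu *
    \int[mu]_(u in `[0, 1]) ((1 - u) `^ (nu - 1) * f u).
Proof.
move=> nu1 cf f0 fL.
by rewrite /generalized_gini (Rintegral_onem_powR_profiled nu1 cf f0 fL) !mulrA.
Qed.

End lorenz_curves.

(** * Gamma kernels and the beta integral *)

Section gamma_convolution.
Local Set Implicit Arguments.
Local Unset Strict Implicit.
Local Open Scope classical_set_scope.
Context {R : realType}.
Implicit Types (p q s t u x : R).
Let mu := @lebesgue_measure R.

Definition gamma_kernel p t : R := if 0 <= t then t `^ p * expR (- t) else 0.

(** Extended-real counterpart of [Gamma (p + 1)]: Tonelli's theorem applies to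
    it before finiteness is known. *)
Definition gamma_mass p : \bar R := (\int[mu]_t (gamma_kernel p t)%:E)%E.

Definition euler_beta p q : R :=
  \int[mu]_(v in `[0, 1]) (v `^ p * (1 - v) `^ q).

Lemma gamma_kernel_ge0 p t : 0 <= gamma_kernel p t.
Proof.
rewrite /gamma_kernel; case: ifP => // _.
by rewrite mulr_ge0 ?powR_ge0 ?expR_ge0.
Qed.

Lemma measurable_gamma_kernel p : measurable_fun setT (gamma_kernel p).
Proof.
apply: measurable_fun_ifT => //; first exact: measurable_fun_ler.
by apply: measurable_funM; [exact: measurable_powR|exact: measurableT_comp].
Qed.

Lemma gamma_kernelE p : gamma_kernel p =
  (fun t => pospow p t * expR (- t)) \_ `[0, +oo[.
Proof.
apply/funext => t; rewrite patchE /gamma_kernel mem_setE in_itv/= andbT.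
by case: ifP => // t0; rewrite pospowE.
Qed.

Lemma gamma_massE p : gamma_mass p =
  (\int[mu]_(t in `[0%R, +oo[) (pospow p t * expR (- t))%:E)%E.
Proof.
rewrite /gamma_mass gamma_kernelE [RHS]integral_mkcond.
by apply: eq_integral => t _; rewrite !patchE; case: ifP.
Qed.

Lemma Gamma_mass z : Gamma z = fine (gamma_mass (z - 1)).
Proof.
rewrite gamma_massE -integral_itv_obnd_cbnd; last first.
  apply/measurable_EFinP/measurable_funTS.
  apply: measurable_funM; last exact: measurableT_comp.
  apply: (measurableT_comp (measurable_powR _)).
  by apply: measurable_maxr => //; exact: measurable_cst.
apply: (congr1 fine); apply: eq_integral => t.
by rewrite inE/= in_itv/= andbT => t0; rewrite pospowE// ltW.
Qed.

(** For [p > 0], put [y = t / (2 * p)] and raise [y <= expR y] to the power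
    [p]; this makes [t `^ p * expR (- t)] at most a multiple of
    [expR (- t / 2)]. *)
Lemma powR_le_expR p : 0 <= p ->
  exists2 C : R, 0 <= C & forall t, 0 <= t -> t `^ p <= C * expR (2^-1 * t).
Proof.
rewrite le_eqVlt => /predU1P[<-|p0].
  exists 1 => // t t0.
  by rewrite powRr0 mul1r -expR0 ler_expR mulr_ge0.
exists ((2 * p) `^ p); first exact: powR_ge0.
move=> t t0.
have p2 : 0 < 2 * p by rewrite mulr_gt0.
have {1}-> : t = 2 * p * (t / (2 * p)) by rewrite mulrC divfK ?gt_eqF.
have d0 : 0 <= t / (2 * p) by rewrite divr_ge0// ltW.
rewrite powRM ?(ltW p2)//.
rewrite ler_wpM2l ?powR_ge0//.
have -> : 2^-1 * t = t / (2 * p) * p by field; rewrite gt_eqF.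
rewrite expRM; apply: ge0_ler_powR; rewrite ?nnegrE ?expR_ge0// ?(ltW p0)//.
by apply: le_trans (expR_ge1Dx _); rewrite lerDr.
Qed.

(** The kernel is dominated by a multiple of the density of the exponential
    distribution of rate [1 / 2], whose mass is 1. *)
Lemma gamma_mass_lty p : 0 <= p -> (gamma_mass p < +oo)%E.
Proof.
move=> /powR_le_expR[C C0 HC].
apply: (@le_lt_trans _ _ (\int[mu]_t (2 * C * exponential_pdf 2^-1 t)%:E)%E).
  apply: ge0_le_integral => //=.
  - by move=> t _; rewrite lee_fin gamma_kernel_ge0.
  - by apply/measurable_EFinP; exact: measurable_gamma_kernel.
  - apply/measurable_EFinP/measurable_funM => //.
          exact: measurable_exponential_pdf.
  - move=> t _; rewrite lee_fin /gamma_kernel; case: ifPn => [t0|_]; last first.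
      by apply: mulr_ge0; [exact: mulr_ge0|exact: exponential_pdf_ge0].
    rewrite exponential_pdfE//.
    have -> : 2 * C * (2^-1 * expR (- 2^-1 * t)) =
              C * expR (2^-1 * t) * expR (- t).
      rewrite -[RHS]mulrA -expRD (_ : 2^-1 * t - t = - 2^-1 * t); last by field.
      by field.
     by rewrite ler_wpM2r ?expR_ge0// HC.
under eq_integral do rewrite EFinM.
rewrite ge0_integralZl_EFin//.
- by rewrite integral_exponential_pdf// mule1 ltry.
- by move=> t _; rewrite lee_fin exponential_pdf_ge0.
- by apply/measurable_EFinP; exact: measurable_exponential_pdf.
- by rewrite mulr_ge0.
Qed.

(** On [[1, 2]] the kernel is at least [expR (- 2)]. *)
Lemma gamma_mass_gt0 p : 0 <= p -> (0 < gamma_mass p)%E.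
Proof.
move=> p0.
apply: (@lt_le_trans _ _ (\int[mu]_(t in `[1%R, 2%R]) (expR (- 2))%:E)%E).
  rewrite integral_cst//= lebesgue_measure_itv/= lte_fin ltr1n -EFinB -EFinM.
  by rewrite lte_fin mulr_gt0 ?expR_gt0//; lra.
apply: (@le_trans _ _ (\int[mu]_(t in `[1%R, 2%R]) (gamma_kernel p t)%:E)%E).
  apply: ge0_le_integral => //=.
  - by apply/measurable_EFinP/measurable_funTS; exact: measurable_gamma_kernel.
  - move=> t; rewrite in_itv/= => /andP[t1 t2]; rewrite lee_fin /gamma_kernel.
    rewrite (le_trans ler01 t1) -[leLHS]mul1r ler_pM ?expR_ge0//.
      by rewrite -(powRr0 t) ler_powR.
    by rewrite ler_expR lerN2.
apply: ge0_subset_integral => //.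
- by apply/measurable_EFinP; exact: measurable_gamma_kernel.
- by move=> t _; rewrite lee_fin gamma_kernel_ge0.
Qed.

Lemma continuous_pospow_expRN p : 0 <= p ->
  continuous (fun t : R => pospow p t * expR (- t)).
Proof.
move=> p0 t; apply: cvgM; first exact: continuous_pospow.
apply: (@continuous_comp _ _ _ (fun x : R => - x) expR).
  exact: continuousN.
exact: continuous_expR.
Qed.

Lemma gamma_mass_translate p s : 0 <= p ->
  (\int[mu]_u (gamma_kernel p (u - s))%:E)%E = gamma_mass p.
Proof.
move=> p0; rewrite gamma_massE.
pose G u := pospow p (u - s) * expR (- (u - s)).
have cG : continuous G.
  move=> u; apply: (@continuous_comp _ _ _ (fun x : R => x - s)
    (fun t : R => pospow p t * expR (- t))).
    by apply: cvgB; [exact: cvg_id|exact: cvg_cst].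
  exact: continuous_pospow_expRN.
transitivity (\int[mu]_(u in `[s, +oo[) (G u)%:E)%E.
  rewrite [RHS]integral_mkcond; apply: eq_integral => u _.
  rewrite patchE mem_setE in_itv/= andbT /gamma_kernel subr_ge0.
  by case: ifP => // su; rewrite /G pospowE// subr_ge0.
have F'E : (fun x : R => x + s)^`() = cst 1.
  apply/funext => x; rewrite derive1E.
  have [_ ->] := is_deriveD (is_derive_id x 1) (is_derive_cst s x 1).
  by rewrite addr0.
have := @increasing_ge0_integration_by_substitutiony R (fun x => x + s) G 0.
rewrite add0r => ->.
- by apply: eq_integral => t _; rewrite F'E /= fctE/= mulr1 /G addrK.
- by move=> x y _ _ xy; rewrite ltrD2r.
- by rewrite F'E => x _; exact: cvg_cst.
- by rewrite F'E; exact: is_cvg_cst.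
- by rewrite F'E; exact: is_cvg_cst.
- split=> [x _|]; first exact: derivableD.
  apply: cvg_at_right_filter.
  by apply: cvgD; [exact: cvg_id|exact: cvg_cst].
- exact: cvg_addrr.
- exact: continuous_subspaceT.
- by move=> x _; rewrite mulr_ge0 ?expR_ge0// pospow_ge0.
Qed.

(** The integrand lives on [0 <= s <= u], where the exponentials multiply to
    the constant [expR (- u)]; the substitution [s = u * v] then extracts
    [u * u `^ p * u `^ q] from the remaining powers. *)
Lemma gamma_kernel_convolution p q u : 0 <= p -> 0 <= q ->
  (\int[mu]_s (gamma_kernel p s * gamma_kernel q (u - s))%:E =
   (gamma_kernel (p + q + 1) u * euler_beta p q)%:E)%E.
Proof.
move=> p0 q0.
have pq1 : p + q + 1 != 0 by rewrite gt_eqF// ltr_wpDl// addr_ge0.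
pose G s := pospow p s * pospow q (u - s) * expR (- u).
transitivity (\int[mu]_(s in `[0%R, u]) (G s)%:E)%E.
  rewrite [RHS]integral_mkcond; apply: eq_integral => s _.
  rewrite patchE mem_setE in_itv/= /gamma_kernel subr_ge0.
  case: (leP 0 s) => s0; last by rewrite mul0r.
  case: (leP s u) => su /=; last by rewrite mulr0.
  rewrite /G !pospowE ?subr_ge0//; congr EFin.
  rewrite mulrACA -expRD; congr (_ * expR _); ring.
have [u0|u0|<-] := ltgtP 0 u; last 2 first.
- rewrite set_itv_ge; last by rewrite bnd_simp -ltNge.
  by rewrite integral_set0 /gamma_kernel leNgt u0 mul0r.
- by rewrite set_itv1 integral_set1 /gamma_kernel lexx powR0// !mul0r.
have cpq : continuous (fun v : R => pospow p v * pospow q (1 - v)).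
  move=> v; apply: cvgM; first exact: continuous_pospow.
  by apply: continuous_onem_comp; exact: continuous_pospow.
have cG : continuous G.
  move=> s; apply: cvgM; last exact: cvg_cst.
  apply: cvgM; first exact: continuous_pospow.
  apply: (@continuous_comp _ _ _ (fun x : R => u - x) (pospow q)).
    by apply: cvgB; [exact: cvg_cst|exact: cvg_id].
  exact: continuous_pospow.
rewrite -[LHS]fineK; last first.
  by apply: integrable_fin_num => //; exact: continuous_integrable_itv.
congr EFin; rewrite -/(Rintegral mu `[0, u] G).
have := Rintegral_affine 0 u0 cG; rewrite add0r => ->.
rewrite /gamma_kernel ltW//.
have -> : u `^ (p + q + 1) = u * (u `^ p * u `^ q).
  rewrite -powRD; last by rewrite (gt_eqF u0) implybT.
  by rewrite -[p + q in RHS](addrK 1) mulr_powRB1 ?ltW// ltr_wpDl// addr_ge0.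
transitivity (u * \int[mu]_(v in `[0, 1])
    (u `^ p * u `^ q * expR (- u) * (pospow p v * pospow q (1 - v)))).
  congr (_ * _); apply: eq_Rintegral => v /[!inE]/= /[!in_itv]/= /andP[v0 v1].
  rewrite /G add0r -[X in X - _]mulr1 -mulrBr.
  rewrite !pospowE ?mulr_ge0 ?subr_ge0 ?(ltW u0)//.
  by rewrite !powRM ?subr_ge0 ?(ltW u0)//; ring.
rewrite RintegralZl//; last exact: continuous_integrable_itv.
rewrite !mulrA; congr (_ * _); rewrite /euler_beta.
apply: eq_Rintegral => v /[!inE]/= /[!in_itv]/= /andP[v0 v1].
by rewrite !pospowE ?subr_ge0.
Qed.

Lemma euler_beta_ge0 p q : 0 <= euler_beta p q.
Proof.
by apply: Rintegral_ge0 => v _; rewrite mulr_ge0 ?powR_ge0.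
Qed.

(** Both sides are the mass of the convolution of two kernels: integrating
    over [u] before [s] gives the product on the left by translation, and
    integrating over [s] before [u] gives the right-hand side by the
    convolution formula. *)
Lemma gamma_mass_mul p q : 0 <= p -> 0 <= q ->
  (gamma_mass p * gamma_mass q =
   gamma_mass (p + q + 1) * (euler_beta p q)%:E)%E.
Proof.
move=> p0 q0.
have mK r := measurable_gamma_kernel r.
pose h z := (gamma_kernel p z.1 * gamma_kernel q (z.2 - z.1))%:E.
transitivity (\int[mu]_s \int[mu]_u h (s, u))%E.
  rewrite /gamma_mass -ge0_integralZr//; last 3 first.
  - by apply/measurable_EFinP; exact: mK.
  - by move=> s _; rewrite lee_fin gamma_kernel_ge0.
  - by apply: integral_ge0 => s _; rewrite lee_fin gamma_kernel_ge0.
  apply: eq_integral => s _.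
  rewrite -/(gamma_mass q) -(gamma_mass_translate s q0).
  rewrite -ge0_integralZl//=.
  - apply/measurable_EFinP; apply: measurableT_comp => //.
    exact: measurable_funB.
  - by move=> u _; rewrite lee_fin gamma_kernel_ge0.
  - by rewrite lee_fin gamma_kernel_ge0.
rewrite fubini_tonelli; last 2 first.
- apply/measurable_EFinP; apply: measurable_funM.
    by apply: measurableT_comp => //; exact: measurable_fst.
  apply: measurableT_comp => //.
  by apply: measurable_funB; [exact: measurable_snd|exact: measurable_fst].
- by move=> z; rewrite lee_fin mulr_ge0 ?gamma_kernel_ge0.
rewrite /gamma_mass -ge0_integralZr//; last 3 first.
- by apply/measurable_EFinP; exact: mK.
- by move=> s _; rewrite lee_fin gamma_kernel_ge0.
- by rewrite lee_fin euler_beta_ge0.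
by apply: eq_integral => u _; rewrite /h/= gamma_kernel_convolution.
Qed.

Lemma beta_Gamma a b : 1 <= a -> 1 <= b ->
  euler_beta (a - 1) (b - 1) = Gamma a * Gamma b / Gamma (a + b).
Proof.
move=> a1 b1; rewrite !Gamma_mass.
have a0 : 0 <= a - 1 by rewrite subr_ge0.
have b0 : 0 <= b - 1 by rewrite subr_ge0.
have -> : a + b - 1 = (a - 1) + (b - 1) + 1 by ring.
set c := _ + _ + 1.
have c0 : 0 <= c by rewrite addr_ge0// addr_ge0.
have fin p : 0 <= p -> gamma_mass p \is a fin_num.
  by move=> p0; rewrite ge0_fin_numE ?gamma_mass_lty// ltW// gamma_mass_gt0.
rewrite -fineM ?fin// gamma_mass_mul// fineM ?fin//=.
rewrite [X in X / _]mulrC mulfK// gt_eqF//.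
by rewrite fine_gt0// gamma_mass_gt0// gamma_mass_lty.
Qed.

End gamma_convolution.

(** * Moments of the profiles *)

Section profile_moments.
Local Set Implicit Arguments.
Local Unset Strict Implicit.
Local Open Scope classical_set_scope.
Context {R : realType}.
Let mu := @lebesgue_measure R.
Variable nu : R.
Hypothesis nu_ge1 : 1 <= nu.

Let nu1_ge0 : 0 <= nu - 1. Proof. by rewrite subr_ge0. Qed.

Lemma moment_pospow alpha : 0 <= alpha ->
  \int[mu]_(u in `[0, 1]) ((1 - u) `^ (nu - 1) * pospow alpha u) =
  Gamma nu * Gamma (alpha + 1) / Gamma (1 + alpha + nu).
Proof.
move=> alpha0.
rewrite [Gamma nu * _]mulrC.
rewrite (_ : 1 + alpha + nu = (alpha + 1) + nu); last by ring.
have a1 : 1 <= alpha + 1 by rewrite lerDr.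
rewrite -(beta_Gamma a1 nu_ge1) addrK; apply: eq_Rintegral => u.
by rewrite inE/= in_itv/= => /andP[u0 _]; rewrite pospowE// mulrC.
Qed.

Lemma moment_onem_pospow alpha : 0 < alpha ->
  \int[mu]_(u in `[0, 1]) ((1 - u) `^ (nu - 1) * (1 - pospow alpha (1 - u))) =
  nu^-1 - (alpha + nu)^-1.
Proof.
move=> alpha0; have an1 : 0 < alpha + nu - 1 by rewrite -addrA ltr_pwDl.
have iw p : 0 <= p -> mu.-integrable `[0, 1] (EFin \o (fun u => (1 - u) `^ p)).
  move=> p0.
  apply: (@eq_integrable _ _ _ mu _ _
    (EFin \o (fun u => pospow p (1 - u)))) => //.
    move=> u /[!inE]/= /[!in_itv]/= /andP[u0 u1].
    by rewrite pospowE// subr_ge0.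
  apply: continuous_integrable_itv; apply: continuous_onem_comp.
  exact: continuous_pospow.
transitivity (\int[mu]_(u in `[0, 1])
    ((1 - u) `^ (nu - 1) - (1 - u) `^ (alpha + nu - 1))).
  apply: eq_Rintegral => u /[!inE]/= /[!in_itv]/= /andP[_ u1].
  have nua : nu - 1 + alpha = alpha + nu - 1 by ring.
  by rewrite pospowE ?subr_ge0// mulrBr mulr1 -powRD nua// gt_eqF.
rewrite RintegralB//; [|by apply: iw; rewrite // ltW..].
by rewrite !Rintegral_onem_powR01 ?(ltW an1)// !subrK.
Qed.

End profile_moments.

(** * The indices of the four curves *)

Theorem mainTheorem4 (R : realType) (delta alpha1 alpha2 pi1 pi2 : R)
    (delta_ge0 : 0 <= delta) (delta_lt1 : delta < 1)
    (alpha1_ge1 : 1 <= alpha1)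
    (alpha2_gt0 : 0 < alpha2) (alpha2_le1 : alpha2 <= 1)
    (pi1_gt0 : 0 < pi1) (pi2_gt0 : 0 < pi2) (pi12_lt1 : pi1 + pi2 < 1) :
  (gini (lorenz1 delta) = delta
   /\ gini (lorenz2 delta alpha1) = (alpha1 + 2 * delta - 1) / (1 + alpha1)
   /\ gini (lorenz3 delta alpha2)
      = (1 - alpha2 + 2 * alpha2 * delta) / (1 + alpha2)
   /\ gini (lorenz4 delta alpha1 alpha2 pi1 pi2)
      = pi1 * delta
        + pi2 * ((alpha1 - 1 + 2 * delta) / (1 + alpha1))
        + (1 - pi1 - pi2)
          * ((1 - alpha2 + 2 * alpha2 * delta) / (1 + alpha2)))
  /\ (forall nu : R, 1 < nu ->
      generalized_gini nu (lorenz1 delta) = 1 - (1 - delta) `^ nu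
      /\ generalized_gini nu (lorenz2 delta alpha1)
         = 1 - nu * (nu + 1) * (1 - delta) `^ nu * Gamma nu
               * Gamma (alpha1 + 1) / Gamma (1 + alpha1 + nu)
      /\ generalized_gini nu (lorenz3 delta alpha2)
         = 1 - (1 + nu) * alpha2 * (1 - delta) `^ nu / (alpha2 + nu)).
Proof.
have a1_gt0 : 0 < alpha1 by rewrite (lt_le_trans ltr01).
have c2 : continuous (pospow alpha1) by apply/continuous_pospow/ltW.
have c3 a : 0 < a -> continuous (fun u : R => 1 - pospow a (1 - u)).
  move=> a0 u; apply: cvgB; first exact: cvg_cst.
  by apply: continuous_onem_comp; apply: continuous_pospow; exact: ltW.
have z3 a : 1 - pospow a (1 - 0) = 0 :> R.
  by rewrite subr0 pospowE// powR1 subrr.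
have L1 := lorenz1_profile delta_lt1.
have L2 := lorenz2_profile delta_lt1 a1_gt0.
have L3 := lorenz3_profile delta_lt1 alpha2.
have i1 := profiled_integrable (c3 _ ltr01) L1.
have i2 := profiled_integrable c2 L2.
have i3 := profiled_integrable (c3 _ alpha2_gt0) L3.
have gg3 a L nu : 0 < a -> 1 <= nu ->
    profiled_by delta (fun u => 1 - pospow a (1 - u)) L ->
    generalized_gini nu L =
    1 - (1 + nu) * a * (1 - delta) `^ nu / (a + nu).
  move=> a0 nu1 fL; have nu0 : 0 < nu by rewrite (lt_le_trans ltr01).
  rewrite (generalized_gini_profiled delta_ge0 delta_lt1 nu1
    (c3 _ a0) (z3 a) fL).
  rewrite moment_onem_pospow//; field.
  by rewrite !gt_eqF ?addr_gt0.
have d0 : 0 <= 1 - delta by rewrite subr_ge0 ltW.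
have g1 : gini (lorenz1 delta) = delta.
  by rewrite gini_generalized// (gg3 _ _ _ _ _ L1)// powRr1//; field.
have m2 : \int[lebesgue_measure]_(u in `[0, 1]%classic)
    ((1 - u) `^ (1 - 1) * pospow alpha1 u) = (alpha1 + 1)^-1.
  rewrite -Rintegral_powR01 ?(ltW a1_gt0)//; apply: eq_Rintegral => u.
  by rewrite inE/= in_itv/= => /andP[u0 _]; rewrite subrr powRr0 mul1r pospowE.
have z2 : pospow alpha1 0 = 0 by rewrite pospowE// powR0// gt_eqF.
have g2 : gini (lorenz2 delta alpha1) = (alpha1 + 2 * delta - 1) / (1 + alpha1).
  rewrite gini_generalized//.
  rewrite (generalized_gini_profiled delta_ge0 delta_lt1 (lexx 1) c2 z2 L2).
  by rewrite m2 powRr1//; field; rewrite gt_eqF// addr_gt0.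
have g3 : gini (lorenz3 delta alpha2) =
    (1 - alpha2 + 2 * alpha2 * delta) / (1 + alpha2).
  rewrite gini_generalized// (gg3 _ _ _ _ _ L3)// powRr1//; field.
  by rewrite gt_eqF// addr_gt0.
split; last first.
  move=> nu /ltW nu1; have nu0 : 0 < nu by rewrite (lt_le_trans ltr01).
  split; last split.
  - rewrite (gg3 _ _ _ _ _ L1)//; field; by rewrite gt_eqF// addr_gt0.
  - rewrite (generalized_gini_profiled delta_ge0 delta_lt1 nu1 c2 z2 L2).
    by rewrite moment_pospow ?(ltW a1_gt0)// !mulrA.
  - exact: gg3.
do 3!split => //.
rewrite /lorenz4 gini_mixture// g1 g2 g3.
by rewrite (_ : alpha1 - 1 + 2 * delta = alpha1 + 2 * delta - 1)//; ring.
Qed.
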